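(* Let $G$ be a very well-covered graph, let $s\ge 1$ and let $e_1,\ldots,e_s$ be edges of $G$ (not necessarily distinct). Then \[\operatorname{reg}\big((I(G)^{s+1}:e_1\cdots e_s)\big)\le \nu(G)+1.\]
   Context: All graphs are finite and simple. $I(G)=(uv\mid\{u,v\}\in E(G))\subseteq K[V(G)]$ is the edge ideal; an edge $e=\{a,b\}$ is identified with the monomial $ab$, so $e_1\cdots e_s$ is a monomial. $\operatorname{reg}$ is Castelnuovo–Mumford regularity. $G$ is very well-covered if it has no isolated vertices, all minimal vertex covers have the same size, and this size equals $|V(G)|/2$. $\nu(G)$ is the induced matching number of $G$ (maximum number of pairwise disjoint edges no two of which are joined by an edge of $G$). *)

(* Defs.v *)
From HB Require Import structures.
From mathcomp Require Import all_boot all_order all_algebra.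
Set Implicit Arguments. Unset Strict Implicit. Unset Printing Implicit Defensive.
Import GRing.Theory.

Definition vertex_cover n (e : rel 'I_n) (C : {set 'I_n}) : bool :=
  [forall u, forall v, e u v ==> (u \in C) || (v \in C)].

Definition very_well_covered n (e : rel 'I_n) : Prop :=
  (forall v : 'I_n, exists w, e v w) /\
  (forall C : {set 'I_n}, minset (vertex_cover e) C -> 2 * #|C| = n).

Definition induced_matching n (e : rel 'I_n) (M : {set 'I_n * 'I_n}) : bool :=
  [forall p in M, e p.1 p.2] &&
  [forall p in M, forall q in M, (p != q) ==>
     [forall x in [set p.1; p.2], forall y in [set q.1; q.2],
        (x != y) && ~~ e x y]].

Definition nu n (e : rel 'I_n) : nat :=
  \max_(M : {set 'I_n * 'I_n} | induced_matching e M) #|M|.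

Definition mono n := {ffun 'I_n -> nat}.

(* A monomial ideal is represented by its (upward closed) set of monomials,
   as a boolean predicate on exponent vectors. *)

Definition edge_mono n (p : 'I_n * 'I_n) : mono n :=
  [ffun w => ((w == p.1) + (w == p.2))%N].

Definition edge_power_mem n (e : rel 'I_n) (k : nat) (a : mono n) : bool :=
  [exists t : k.-tuple ('I_n * 'I_n),
     all (fun p => e p.1 p.2) t &&
     [forall v, (\sum_(p <- t) edge_mono p v <= a v)%N]].

Definition edges_prod n s (es : 'I_s -> 'I_n * 'I_n) : mono n :=
  [ffun v => (\sum_(k < s) edge_mono (es k) v)%N].

Definition colon_mem n (J : mono n -> bool) (u : mono n) (a : mono n) : bool :=
  J [ffun v => (a v + u v)%N].

(* For a monomial ideal I in S = K[x_0..x_{n-1}], Tor_i^S(I,K)_a is the i-th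
   homology of the degree-a strand of the Koszul complex I (x) /\ K^n:
   its i-th term has basis x^(a - 1_F) e_F, for |F| = i, F \subseteq supp a,
   x^(a-1_F) \in I, and d(m e_F) = sum_{v in F} (-1)^{#{w in F, w<v}} x_v m e_{F\v}. *)

Definition koszul_basis n (I : mono n -> bool) (a : mono n) (i : nat)
  : {set {set 'I_n}} :=
  [set F : {set 'I_n} | [&& #|F| == i, F \subset [set v | (0 < a v)%N] &
                           I [ffun v => (a v - (v \in F))%N]]].

Definition nsets n := #|{: {set 'I_n}}|.

(* matrix of the differential C_i -> C_{i-1} (row-vector convention),
   padded by zero rows/columns to all subsets of 'I_n *)
Definition koszul_mx (K : fieldType) n (I : mono n -> bool) (a : mono n) (i : nat)
  : 'M[K]_(nsets n) :=
  \matrix_(p < nsets n, q < nsets n)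
    (let F := enum_val p in let G := enum_val q in
     if (F \in koszul_basis I a i) && (G \in koszul_basis I a i.-1)
     then (\sum_(v in F | G == F :\ v) (-1) ^+ #|[set w in F | (w < v)%N]|)%R
     else 0%R).

Definition betti (K : fieldType) n (I : mono n -> bool) (i : nat) (a : mono n) : nat :=
  (#|koszul_basis I a i| - \rank (koszul_mx K I a i) - \rank (koszul_mx K I a i.+1))%N.

Definition reg_le (K : fieldType) n (I : mono n -> bool) (r : nat) : Prop :=
  forall (i : nat) (a : mono n),
    betti K I i a <> 0%N -> (\sum_(v < n) a v <= i + r)%N.

(* Main.v *)
Require Import Defs.
From mathcomp Require Import all_boot all_order all_algebra.
From mathcomp Require Import zify ring.
Set Implicit Arguments. Unset Strict Implicit. Unset Printing Implicit Defensive.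
Import GRing.Theory.

(* Very well-coveredness yields (Hall, Favaron) an involution [sigma] with
   [v] adjacent to [sigma v] such that every neighbour of [a] is adjacent to
   every neighbour of [sigma a].  Call p, q even-connected when p q e_1 ... e_s
   is a product of s + 1 edges; exchange arguments on multisets of edges show
   that the colon ideal is generated by the products p q of even-connected p, q
   (p = q allowed), that N'(sigma b) is contained in N'(t) when b t is an edge,
   and that sigma a in N'(z) forces a in N'(z) or N'(a) contained in N'(z),
   where N' denotes even-connected neighbourhoods.  The last property says that
   removing N'[v] preserves being sigma-stable up to isolated vertices.

   The regularity is bounded by reg J <= max (reg (J : v) + 1, reg (J, v)),
   deleting the even-connected neighbours v of a vertex b one after the other.
   If N'(b) has minimal size among the non-isolated vertices, an induced
   matching made of edges {t, sigma t} that avoids N'[v] extends by the edge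
   {b, sigma b}, whichever v in N'(b) was chosen, so that every colon is paid
   for by an edge of an induced matching of the graph.

   Regularity is read off the upper Koszul complexes, where the inequality above
   comes from the deletion and the link of v, in one degree of v at a time; this
   treats the non-squarefree generators p ^ 2 without polarization. *)

(** * Exactness of Koszul complexes *)

Section Koszul.
Variables (K : fieldType) (n : nat).
Implicit Types (F G : {set 'I_n}) (v w : 'I_n) (D : pred {set 'I_n}).
Local Open Scope ring_scope.

Definition ksgn v G : K := (-1) ^+ #|[set w in G | (w < v)%N]|.

(** A chain is its coefficient function on faces: in a fixed multidegree the face determines the
    monomial factor. [contract v] and [wedge v] are interior and exterior multiplication by the
    basis vector of [v], and [bound] is the Koszul differential. *)
Definition contract v (z : {set 'I_n} -> K) G : K :=
  if v \in G then 0 else ksgn v G * z (v |: G).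

Definition wedge v (z : {set 'I_n} -> K) F : K :=
  if v \in F then ksgn v (F :\ v) * z (F :\ v) else 0.

Definition bound (z : {set 'I_n} -> K) G : K := \sum_v contract v z G.

Lemma ksgn_sqr v G : ksgn v G * ksgn v G = 1.
Proof. by rewrite /ksgn -expr2 sqrr_sign. Qed.

Lemma ksgnU v w G : w \notin G ->
  ksgn v (w |: G) = (if (w < v)%N then -1 else 1) * ksgn v G.
Proof.
move=> wG; rewrite /ksgn.
have -> : [set u in w |: G | (u < v)%N] =
  if (w < v)%N then w |: [set u in G | (u < v)%N] else [set u in G | (u < v)%N].
  apply/setP=> u; case: ifP => wv; rewrite !inE;
  by case: eqVneq => //= ->; rewrite wv ?andbF.
case: ifP => _; last by rewrite mul1r.
by rewrite cardsU1 inE (negPf wG) exprS.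
Qed.

Lemma ksgn_swap v w G : v != w -> v \notin G -> w \notin G ->
  ksgn v (w |: G) * ksgn w G = - (ksgn w (v |: G) * ksgn v G).
Proof.
move=> vw vG wG; rewrite !ksgnU //.
case: (ltngtP v w) vw => [||/val_inj->]; rewrite ?eqxx // => _ _;
  by rewrite !(mul1r, mulN1r) mulNr ?opprK mulrC.
Qed.

Lemma contractC v w z G :
  contract v (contract w z) G = - contract w (contract v z) G.
Proof.
rewrite /contract !inE (eq_sym w v).
case: (boolP (v \in G)) => vG; case: (boolP (w \in G)) => wG;
  rewrite ?orbT ?mulr0 ?oppr0 // !orbF.
case: eqVneq => [_|vw]; first by rewrite !mulr0 oppr0.
rewrite !mulrA (mulrC (ksgn v G)) (mulrC (ksgn w G)) setUCA.
by rewrite ksgn_swap ?mulNr ?opprK // eq_sym.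
Qed.

Lemma contractK v z G : contract v (contract v z) G = 0.
Proof. by rewrite /contract; case: ifP => // _; rewrite setU11 mulr0. Qed.

Lemma contract_wedge v w z G : v != w ->
  contract v (wedge w z) G = - wedge w (contract v z) G.
Proof.
move=> vw; rewrite /contract /wedge !inE (eq_sym w v) (negPf vw) /=.
case: (boolP (w \in G)) => wG; last by rewrite mulr0 if_same oppr0.
case: (boolP (v \in G)) => vG; first by rewrite mulr0 oppr0.
have -> : (v |: G) :\ w = v |: G :\ w.
  by apply/setP=> u; rewrite !inE; case: eqVneq => //= ->; rewrite eq_sym (negPf vw).
have vG' : v \notin G :\ w by rewrite inE negb_and vG orbT.
have := ksgn_swap vw vG' (negbT (setD11 w G)).
rewrite setD1K // => E; rewrite !mulrA -mulNr; congr (_ * _).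
have sB := ksgn_sqr w (v |: G :\ w); have ss := ksgn_sqr w (G :\ w).
rewrite -[LHS]mulr1 -{1}ss.
transitivity (- (ksgn w (G :\ w) * ksgn v (G :\ w)) *
   (ksgn w (v |: G :\ w) * ksgn w (v |: G :\ w))); last by rewrite sB mulr1.
by rewrite mulrACA E; ring.
Qed.

Lemma contract_wedge_id v z G :
  contract v (wedge v z) G + wedge v (contract v z) G = z G.
Proof.
rewrite /contract /wedge !inE !eqxx /=.
case: (boolP (v \in G)) => vG; rewrite ?addr0 ?add0r.
  by rewrite setD1K // mulrA ksgn_sqr mul1r.
by rewrite setU1K // mulrA ksgn_sqr mul1r.
Qed.

Lemma contractD v y z G :
  contract v (fun F => y F + z F) G = contract v y G + contract v z G.
Proof. by rewrite /contract; case: ifP; rewrite ?addr0 ?mulrDr. Qed.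

Lemma contract_sum v (I : finType) (z : I -> {set 'I_n} -> K) G :
  contract v (fun F => \sum_i z i F) G = \sum_i contract v (z i) G.
Proof.
rewrite /contract; case: ifP => _; last by rewrite mulr_sumr.
by rewrite big1.
Qed.

Lemma wedge_bound v z G : wedge v (bound z) G = \sum_w wedge v (contract w z) G.
Proof.
rewrite /wedge /bound; case: ifP => _; last by rewrite big1.
by rewrite mulr_sumr.
Qed.

Lemma contract_bound v z G : contract v (bound z) G = - bound (contract v z) G.
Proof.
rewrite /bound contract_sum -sumrN; apply: eq_bigr => w _; exact: contractC.
Qed.

Lemma eq_contract v y z : y =1 z -> contract v y =1 contract v z.
Proof. by move=> yz G; rewrite /contract yz. Qed.

Lemma eq_wedge v y z : y =1 z -> wedge v y =1 wedge v z.
Proof. by move=> yz G; rewrite /wedge yz. Qed.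

Lemma eq_bound y z : y =1 z -> bound y =1 bound z.
Proof. by move=> yz G; apply: eq_bigr => v _; apply: eq_contract. Qed.

Lemma boundD y z G : bound (fun F => y F + z F) G = bound y G + bound z G.
Proof.
by rewrite /bound -big_split; apply: eq_bigr => v _; apply: contractD.
Qed.

Lemma bound_bound z G : bound (bound z) G = 0.
Proof.
rewrite /bound; under eq_bigr do rewrite contract_sum.
pose f v w := contract v (contract w z) G.
(* The diagonal needs its own argument, since antisymmetry alone does not make it vanish in
   characteristic 2. *)
have fv v : f v v = 0 by apply: contractK.
have fN v w : f v w = - f w v by apply: contractC.
have -> : \sum_v \sum_w f v w =
    \sum_(v < n) \sum_(w < n | (v < w)%N) f v w +
    \sum_(v < n) \sum_(w < n | (w < v)%N) f v w.
  rewrite -big_split; apply: eq_bigr => v _ /=.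
  rewrite (bigD1 v) //= fv add0r (bigID (fun w : 'I_n => (v < w)%N)) /=.
  congr (_ + _); apply: eq_bigl => w; rewrite -(inj_eq val_inj) /=; lia.
rewrite [X in _ + X](exchange_big_dep predT) //= -big_split big1 //= => v _.
by rewrite -big_split big1 // => w _ /=; rewrite fN addNr.
Qed.

(** The Clifford relations make [wedge v] a contracting homotopy of the full simplex; both the cone
    argument and the deletion-link argument rest on it. *)
Lemma bound_wedge v z G : bound (wedge v z) G = z G - wedge v (bound z) G.
Proof.
rewrite wedge_bound /bound (bigD1 v) //= [X in _ - X](bigD1 v) //=.
rewrite opprD addrA -{1}(contract_wedge_id v z G) addrK -sumrN; congr (_ + _).
by apply: eq_bigr => w wv; rewrite contract_wedge.
Qed.

Definition supported D i (z : {set 'I_n} -> K) : Prop :=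
  forall F, z F != 0 -> D F /\ #|F| = i.

(** For a simplicial complex this is the vanishing of reduced homology in dimension i - 1: [i]
    counts the vertices of a face, and the empty face is allowed. *)
Definition exact_at D i : Prop :=
  forall z, supported D i z -> (forall G, bound z G = 0) ->
  exists2 y, supported D i.+1 y & forall G, bound y G = z G.

Lemma eq_exact_at D D' i : D =1 D' -> exact_at D i -> exact_at D' i.
Proof.
move=> DD' ex z zD bz; have [|y yD by_] := ex z _ bz.
  by move=> F /zD; rewrite DD'.
by exists y => // F /yD; rewrite DD'.
Qed.

Lemma exact_at_empty D i : D =1 xpred0 -> exact_at D i.
Proof.
move=> D0 z zD _; exists z => [F /zD[]|G]; first by rewrite D0.
have z0 F : z F = 0 by case: (eqVneq (z F) 0) => // /zD[]; rewrite D0.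
by rewrite z0 /bound big1 // => v _; rewrite /contract; case: ifP; rewrite ?z0 ?mulr0.
Qed.

Lemma supported_wedge D D' v i z :
  supported D i z -> (forall F, v \notin F -> D F -> D' (v |: F)) ->
  supported D' i.+1 (wedge v z).
Proof.
move=> zD DD' F; rewrite /wedge; case: ifP; last by rewrite eqxx.
move=> vF; rewrite mulf_eq0 negb_or => /andP[_ /zD[DF iF]].
rewrite -(setD1K vF) cardsU1 setD11 iF; split=> //.
by apply: DD' => //; rewrite setD11.
Qed.

Lemma exact_at_cone D v i :
  (forall F, v \notin F -> D F -> D (v |: F)) -> exact_at D i.
Proof.
move=> cD z zD bz; exists (wedge v z); first exact: supported_wedge cD.
move=> G; rewrite bound_wedge /wedge; case: ifP => _; rewrite ?bz ?mulr0 ?subr0 //.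
Qed.

(** The long exact sequence of deletion and link, by hand. Contracting a cycle by [v] gives a cycle
    of the link; a filling [y1] of it moves the cycle, within its homology class, into the deletion,
    where it is filled. *)
Lemma exact_at_del_link D v i :
  (forall F, D (v |: F) -> D F) ->
  exact_at (fun F => (v \notin F) && D F) i ->
  (forall j, i = j.+1 -> exact_at (fun F => (v \notin F) && D (v |: F)) j) ->
  exact_at D i.
Proof.
move=> Dv exdel exlk z zD bz.
have [y1 y1D by1] : exists2 y,
    supported (fun F => (v \notin F) && D (v |: F)) i y
    & forall G, bound y G = contract v z G.
  case: i zD exlk {exdel} => [|i] zD exlk.
    exists (fun=> 0) => [F|G]; first by rewrite eqxx.
    rewrite /bound big1 => [|w _]; last by rewrite /contract mulr0 if_same.
    rewrite /contract; case: ifP => // vG.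
    case: (eqVneq (z (v |: G)) 0) => [->|/zD[_]]; first by rewrite mulr0.
    by rewrite cardsU1 vG.
  apply: (exlk i erefl) => [F|G].
    rewrite /contract; case: ifP => [|vF]; first by rewrite eqxx.
    rewrite mulf_eq0 negb_or => /andP[_ /zD[-> /eqP]].
    by rewrite cardsU1 vF eqSS => /eqP.
  have := contract_bound v z G; rewrite /contract bz mulr0 if_same => /eqP.
  by rewrite eq_sym oppr_eq0 => /eqP.
(* Adding this boundary removes from [z] all faces containing [v]. *)
pose z' F := z F + bound (wedge v y1) F.
(* The last term is the restriction of [z] to the faces without [v]. *)
have z'E F : z' F = y1 F + contract v (wedge v z) F.
  rewrite /z' bound_wedge -{1}(contract_wedge_id v z F) (eq_wedge v by1).
  by rewrite addrC [X in _ + X]addrC addrA subrK.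
have z'D : supported (fun F => (v \notin F) && D F) i z'.
  move=> F; rewrite z'E; case: (eqVneq (y1 F) 0) => [->|/y1D[/andP[-> /Dv ->]]] //.
  rewrite add0r /contract /wedge setU11; case: ifP => [|vF]; first by rewrite eqxx.
  by rewrite setU1K ?vF // mulrA ksgn_sqr mul1r => /zD.
have bz' G : bound z' G = 0 by rewrite boundD bz bound_bound addr0.
have [y0 y0D by0] := exdel z' z'D bz'.
exists (fun F => y0 F + - wedge v y1 F) => [F|G].
  case: (eqVneq (y0 F) 0) => [->|/y0D[/andP[_ ->] ->]] //.
  rewrite add0r oppr_eq0.
  by apply: (supported_wedge y1D) => F' _ /andP[].
rewrite boundD by0 /z'.
have -> : bound (fun F => - wedge v y1 F) G = - bound (wedge v y1) G.
  rewrite /bound -sumrN; apply: eq_bigr => w _; rewrite /contract.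
  by case: ifP; rewrite ?oppr0 ?mulrN.
by rewrite addrK.
Qed.

End Koszul.

(** * Quadratic monomial ideals *)

Section KoszulComplex.
Variables (K : fieldType) (n : nat).
Implicit Types (a b c : 'I_n -> nat) (v w : 'I_n) (F : {set 'I_n}).
Implicit Types (J : ('I_n -> nat) -> bool).

Definition upward J := forall a b, (forall w, a w <= b w) -> J a -> J b.

Lemma eq_upward J a b : upward J -> a =1 b -> J a = J b.
Proof. by move=> Jup ab; apply/idP/idP; apply: Jup => w; rewrite ab. Qed.

(** The upper Koszul complex of the monomial ideal [J] in multidegree [a]. *)
Definition kcomplex J a F :=
  (F \subset [set v | 0 < a v]) && J (fun w => a w - (w \in F)).

Definition erase v a w := if w == v then 0 else a w.

Lemma sum_erase v a : \sum_w a w = a v + \sum_w erase v a w.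
Proof.
rewrite (bigD1 v) //= [in RHS](bigD1 v) //= {1}/erase eqxx add0n.
by congr (_ + _); apply: eq_bigr => w wv; rewrite /erase (negPf wv).
Qed.

(** On faces without [v] the exponent of [v] stays [a v], so the deletion is the complex of the
    colon of [J] by that power of [v], in the degree with [v] erased. In the link the face uses up
    one factor, and the power drops by one. *)
Lemma kcomplex_del J a v F : upward J ->
  (v \notin F) && kcomplex J a F =
  kcomplex (fun x => J (fun w => x w + a v * (w == v))) (erase v a) F.
Proof.
move=> Jup; rewrite /kcomplex; case: (boolP (v \in F)) => vF /=.
  by symmetry; apply/negP => /andP[/subsetP/(_ v vF)]; rewrite inE /erase eqxx.
congr (_ && _).
  apply/subsetP/subsetP => sF w wF; have := sF w wF; rewrite !inE /erase;
  by case: eqVneq => // wv; rewrite wv (negPf vF) in wF.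
apply: eq_upward => // w; rewrite /erase; case: eqVneq => [->|_].
  by rewrite (negPf vF); lia.
by rewrite muln0 addn0.
Qed.

Lemma kcomplex_link J a v F : upward J -> 0 < a v ->
  (v \notin F) && kcomplex J a (v |: F) =
  kcomplex (fun x => J (fun w => x w + (a v).-1 * (w == v))) (erase v a) F.
Proof.
move=> Jup av; rewrite /kcomplex; case: (boolP (v \in F)) => vF /=.
  by symmetry; apply/negP => /andP[/subsetP/(_ v vF)]; rewrite inE /erase eqxx.
congr (_ && _).
  rewrite subUset sub1set inE av /=.
  apply/subsetP/subsetP => sF w wF; have := sF w wF; rewrite !inE /erase;
  by case: eqVneq => // wv; rewrite wv (negPf vF) in wF.
apply: eq_upward => // w; rewrite /erase !inE; case: eqVneq => [->|_] /=.
  by rewrite (negPf vF); lia.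
by rewrite muln0 addn0.
Qed.

Lemma kcomplexS J a v F : upward J -> kcomplex J a (v |: F) -> kcomplex J a F.
Proof.
move=> Jup /andP[sF JF]; apply/andP; split.
  by apply: subset_trans sF; apply: subsetUr.
by apply: Jup JF => w; rewrite leq_sub2l // inE; case: (w \in F); rewrite ?orbT ?leq_b1.
Qed.

Lemma eq_kcomplex J J' a : J =1 J' -> kcomplex J a =1 kcomplex J' a.
Proof. by move=> JJ F; rewrite /kcomplex JJ. Qed.

Lemma kcomplex_coneP J a u i : 0 < a u ->
  (forall F, u \notin F -> kcomplex J a F ->
     J (fun w => a w - (w \in u |: F))) ->
  exact_at K (kcomplex J a) i.
Proof.
move=> au JF; apply: (@exact_at_cone _ _ _ u) => F uF DF.
rewrite /kcomplex JF // andbT subUset sub1set inE au /=.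
by case/andP: DF.
Qed.

Lemma exact_kcomplex J a v i : upward J -> 0 < a v ->
  exact_at K (kcomplex (fun x => J (fun w => x w + a v * (w == v)))
    (erase v a)) i ->
  (forall j, i = j.+1 ->
     exact_at K (kcomplex (fun x => J (fun w => x w + (a v).-1 * (w == v)))
       (erase v a)) j) ->
  exact_at K (kcomplex J a) i.
Proof.
move=> Jup av exdel exlk; apply: (@exact_at_del_link _ _ _ v).
- by move=> F; apply: kcomplexS.
- by apply: eq_exact_at exdel => F; rewrite kcomplex_del.
- by move=> j ij; apply: eq_exact_at (exlk j ij) => F; rewrite kcomplex_link.
Qed.

Variable R : rel 'I_n.
Hypothesis R_sym : symmetric R.

(** The edge ideal of a graph with loops: a loop of [R] contributes the square of a variable. *)
Definition quad_ideal a :=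
  [exists p, exists q, R p q && [forall w, (w == p) + (w == q) <= a w]].

Lemma quad_idealP a : reflect
  (exists p q, R p q /\ forall w, (w == p) + (w == q) <= a w) (quad_ideal a).
Proof.
apply: (iffP existsP) => [[p /existsP[q /andP[pq /forallP le]]]|[p [q [pq le]]]].
  by exists p, q.
by exists p; apply/existsP; exists q; rewrite pq; apply/forallP.
Qed.

Lemma upward_quad : upward quad_ideal.
Proof.
move=> a b ab /quad_idealP[p [q [pq le]]]; apply/quad_idealP.
by exists p, q; split=> // w; apply: leq_trans (ab w).
Qed.

Definition quad_colon v a := quad_ideal (fun w => a w + (w == v)).

Lemma upward_colon v : upward (quad_colon v).
Proof. by move=> a b ab; apply: upward_quad => w; rewrite leq_add2r. Qed.

Definition nbrs v := [set w | R v w].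

(* [koszul_bound U d] says that the restriction of the ideal to the variables
   in [U] has regularity at most [d + 1]. *)
Definition koszul_bound (U : {set 'I_n}) d := forall a i,
  (forall w, w \notin U -> a w = 0) -> i + d + 1 < \sum_w a w ->
  exact_at K (kcomplex quad_ideal a) i.

Lemma koszul_bound_sub (U U' : {set 'I_n}) d d' :
  U' \subset U -> d <= d' -> koszul_bound U d -> koszul_bound U' d'.
Proof.
move=> /subsetP sU led kU a i aU' ai; apply: kU; last by lia.
by move=> w wU; apply: aU'; apply: contra wU => /sU.
Qed.

(** If [b] occurs in the degree, the complex is a cone with apex [b], because no generator on these
    variables involves [b]. *)
Lemma koszul_bound_isolated (U : {set 'I_n}) (b : 'I_n) d :
  ~~ R b b -> (forall w, w \in U -> ~~ R b w) ->
  koszul_bound U d -> koszul_bound (b |: U) d.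
Proof.
move=> bb bU kU a i aU ai; case: (posnP (a b)) => [ab|ab].
  apply: kU => // w wU; case: (eqVneq w b) => [->//|wb].
  by apply: aU; rewrite !inE negb_or wb.
apply: (@kcomplex_coneP _ _ b) => // F bF /andP[_ /quad_idealP[p [q [pq le]]]].
apply/quad_idealP; exists p, q; split=> // w.
have awP u : u != b -> ~~ (u \in U) -> a u = 0.
  by move=> ub uU; apply: aU; rewrite !inE negb_or ub.
have [pb qb] : p != b /\ q != b.
  split; apply/eqP => xb; rewrite xb in pq le.
    have := le q; rewrite eqxx; case: (eqVneq q b) => [qb|qb].
      by rewrite qb (negPf bb) in pq.
    case: (boolP (q \in U)) => [/bU|/awP->//]; first by rewrite pq.
  have := le p; rewrite eqxx; case: (eqVneq p b) => [qb|qb].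
    by rewrite qb (negPf bb) in pq.
  case: (boolP (p \in U)) => [/bU|/awP->//]; first by rewrite R_sym pq.
case: (eqVneq w b) => [->|wb]; first by rewrite !(eq_sym b) (negPf pb) (negPf qb).
by have := le w; rewrite inE in_set1 (negPf wb).
Qed.

Lemma exact_colon (U : {set 'I_n}) v d :
  koszul_bound (U :\: (v |: nbrs v)) d ->
  (* Away from [v], the colon is generated by the neighbours of [v], as variables, and the quadrics
     on the other vertices. A neighbour of exponent at least two is a cone apex; one of exponent one
     is removed through its link, lowering [i] and the degree together. Without neighbours in the
     degree, colon and ideal have the same complex. *)
  forall c i, c v = 0 -> (forall w, w \notin U -> c w = 0) ->
  i + d + 1 < \sum_w c w -> exact_at K (kcomplex (quad_colon v) c) i.
Proof.
move=> kU c; have [m] := ubnP (\sum_w c w); elim: m c => // m IH c lem i cv cU ci.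
have vx x w : R v w -> 0 < x w -> w != v -> quad_colon v x.
  move=> vw xw wv; apply/quad_idealP; exists v, w; split=> // u.
  by case: (eqVneq u w) => [->|_]; rewrite ?(negPf wv); lia.
case: (pickP (fun w => R v w && (0 < c w))) => [w /andP[vw cw]|nocw].
  have wv : w != v by apply: contraTneq cw => ->; rewrite cv.
  have [c2|cw1] : 1 < c w \/ c w = 1 by lia.
    apply: (@kcomplex_coneP _ _ w) => // F wF _; apply: (vx _ w) => //.
    by rewrite setU11; lia.
  have := sum_erase w c; rewrite cw1 => cE.
  apply: (@exact_kcomplex _ _ w) => //; first exact: upward_colon.
    (* The deletion of [w] keeps the factor [w], which lies in the colon, so it is a full simplex;
       the degree bound supplies a vertex [u] to serve as apex. *)
    have [u eu] : exists u, 0 < erase w c u.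
      apply/existsP; apply: contraT; rewrite negb_exists => /forallP e0.
      move: ci; rewrite cE big1 => [|u _]; first by lia.
      by apply/eqP; rewrite -leqn0 leqNgt.
    apply: (@kcomplex_coneP _ _ u) => // F _ _; apply: (vx _ w) => //.
    by rewrite eqxx cw1; lia.
  move=> j ij; apply: (eq_exact_at (D := kcomplex (quad_colon v) (erase w c))).
    apply: eq_kcomplex => x; apply: eq_upward; first exact: upward_colon.
    by move=> u; rewrite cw1 mul0n addn0.
  apply: IH; try lia; first by rewrite /erase cv if_same.
  by move=> u uU; rewrite /erase cU ?if_same.
apply: (eq_exact_at (D := kcomplex quad_ideal c)); last first.
  apply: kU => // w; rewrite !inE negb_and negbK => /orP[/orP[/eqP->//|vw]|/cU//].
  by have := nocw w; rewrite vw /=; lia.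
move=> F; congr (_ && _); apply/idP/idP; first by apply: upward_quad => w; lia.
move=> /quad_idealP[p [q [pq le]]]; apply/quad_idealP; exists p, q; split=> // w.
suff pv : p != v /\ q != v.
  have := le w; case: (eqVneq w v) => [->|]; last by lia.
  by rewrite !(eq_sym v); case: pv => /negPf-> /negPf->.
split; apply/eqP => xv; rewrite xv in pq le.
  have := le q; have := nocw q; rewrite pq eqxx /=.
  have := le v; rewrite eqxx cv; case: (eqVneq q v) => [->|_]; lia.
have := le p; have := nocw p; rewrite R_sym pq eqxx /=.
have := le v; rewrite eqxx cv; case: (eqVneq p v) => [->|_]; lia.
Qed.

(** When [v] has exponent one, its deletion is the complex of the colon by [v] and its link that of
    the ideal on the variables other than [v]. Larger exponents make [v] a cone apex, except
    exponent two at a loop. *)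
Lemma koszul_bound_del (U : {set 'I_n}) v d :
  koszul_bound (U :\: (v |: nbrs v)) d -> koszul_bound (U :\ v) d.+1 ->
  koszul_bound U d.+1.
Proof.
move=> kN kU a i aU ai; have aE := sum_erase v a.
have eU w : w \notin U :\ v -> erase v a w = 0.
  by rewrite !inE negb_and negbK /erase; case: eqVneq => //= _ /aU.
have eU' w : w \notin U -> erase v a w = 0.
  by move=> wU; rewrite /erase aU ?if_same.
have ev : erase v a v = 0 by rewrite /erase eqxx.
have eq_colon k : k = 1 ->
    kcomplex (fun x => quad_ideal (fun w => x w + k * (w == v))) (erase v a)
    =1 kcomplex (quad_colon v) (erase v a).
  move=> -> F; apply: eq_kcomplex => x; apply: eq_upward; first exact: upward_quad.
  by move=> w; rewrite mul1n.
case: (posnP (a v)) => [av|av].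
  apply: kU => // w; rewrite !inE negb_and negbK => /orP[/eqP->//|/aU//].
case: (boolP (R v v)) => [vv|vv]; last first.
  have [av2|av1] : 1 < a v \/ a v = 1 by lia.
    apply: (@kcomplex_coneP _ _ v) => // F vF /andP[_ /quad_idealP[p [q [pq le]]]].
    apply/quad_idealP; exists p, q; split=> // w.
    case: (eqVneq w v) => [->|wv]; last by have := le w; rewrite in_setU1 (negPf wv).
    rewrite setU11; have : ~~ ((v == p) && (v == q)).
      by apply/andP => -[/eqP vp /eqP vq]; move: vv; rewrite {1}vp vq pq.
    by lia.
  rewrite av1 in aE.
  apply: (@exact_kcomplex _ _ v) => //; first exact: upward_quad.
    apply: (eq_exact_at (fun F => esym (eq_colon _ av1 F))).
    by apply: (exact_colon kN) => //; lia.
  move=> j ij; apply: (eq_exact_at (D := kcomplex quad_ideal (erase v a))).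
    apply: eq_kcomplex => x; apply: eq_upward; first exact: upward_quad.
    by move=> u; rewrite av1 mul0n addn0.
  by apply: kU => //; lia.
have vx x : 1 < x v -> quad_ideal x.
  move=> xv; apply/quad_idealP; exists v, v; split=> // w.
  by case: (eqVneq w v) => [->|].
have [a3|[a2|av1]] : 2 < a v \/ a v = 2 \/ a v = 1 by lia.
- apply: (@kcomplex_coneP _ _ v) => // F vF _; apply: vx; rewrite setU11; lia.
(* Since the square of [v] is in the ideal, the deletion is a full simplex and the link is the
   complex of the colon by [v]. The degree drops by two and [i] by one; the passage from [d.+1] to
   [d] makes up the difference. *)
- rewrite a2 in aE; apply: (@exact_kcomplex _ _ v) => //; first exact: upward_quad.
    have [u eu] : exists u, 0 < erase v a u.
      apply/existsP; apply: contraT; rewrite negb_exists => /forallP e0.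
      move: ai; rewrite aE big1 => [|u _]; first by lia.
      by apply/eqP; rewrite -leqn0 leqNgt.
    by apply: (@kcomplex_coneP _ _ u) => // F _ _; apply: vx; rewrite a2 eqxx; lia.
  move=> j ij; rewrite a2.
  apply: (eq_exact_at (fun F => esym (eq_colon _ erefl F))).
  by apply: (exact_colon kN) => //; lia.
- rewrite av1 in aE.
  apply: (@exact_kcomplex _ _ v) => //; first exact: upward_quad.
    apply: (eq_exact_at (fun F => esym (eq_colon _ av1 F))).
    by apply: (exact_colon kN) => //; lia.
  move=> j ij; apply: (eq_exact_at (D := kcomplex quad_ideal (erase v a))).
    apply: eq_kcomplex => x; apply: eq_upward; first exact: upward_quad.
    by move=> u; rewrite av1 mul0n addn0.
  by apply: kU => //; lia.
Qed.

Lemma koszul_bound_del_seq (s : seq 'I_n) (U : {set 'I_n}) d :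
  (forall v, v \in s -> koszul_bound (U :\: (v |: nbrs v)) d) ->
  koszul_bound (U :\: [set v in s]) d.+1 -> koszul_bound U d.+1.
Proof.
elim: s U => [|v s IH] U kN kU; first by rewrite set_nil setD0 in kU.
apply: (@koszul_bound_del _ v); first by apply: kN; rewrite mem_head.
apply: IH => [w ws|]; last by rewrite set_cons setDDl in kU *.
(* The colon bounds, assumed on all of [U], pass to the smaller vertex set. *)
apply: koszul_bound_sub (kN w _) => //; last by rewrite inE ws orbT.
by apply: setSD; apply: subD1set.
Qed.

End KoszulComplex.

(** * Perfectly matched graphs *)

Section Matched.
Variables (K : fieldType) (n : nat) (e R : rel 'I_n) (sigma : 'I_n -> 'I_n).
Hypothesis sigmaK : involutive sigma.
Hypothesis e_sigma : forall v, e v (sigma v).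
Hypothesis e_sym : symmetric e.
Hypothesis R_sym : symmetric R.
Hypothesis eR : forall v w, e v w -> R v w.
Hypothesis R_left : forall b t v, e b t -> R (sigma b) v -> R t v.
Hypothesis R_partner : forall z a v, R z (sigma a) -> R a v -> R z a \/ R z v.

Implicit Types (W T : {set 'I_n}).

Definition matched_up_to_isolated W := forall a w,
  a \in W -> w \in W -> R a w -> sigma a \in W.

(** Separation refers to the graph [e], not to [R], because the matchings are to be counted by the
    induced matching number of the graph. *)
Definition separated t u :=
  [forall x in [set t; sigma t], forall y in [set u; sigma u],
     (x != y) && ~~ e x y].

Definition sigma_matching W T :=
  [forall t in T, (t \in W) && (sigma t \in W)] &&
  [forall t in T, forall u in T, (t != u) ==> separated t u].

Lemma separatedC t u : separated t u = separated u t.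
Proof.
by apply/idP/idP => /forall_inP H; apply/forall_inP => x xs; apply/forall_inP => y ys;
  have /forall_inP/(_ x xs) := H y ys; rewrite eq_sym e_sym.
Qed.

Lemma sigma_matchingS W W' T :
  W \subset W' -> sigma_matching W T -> sigma_matching W' T.
Proof.
move=> /subsetP sW /andP[/forall_inP TW TT]; rewrite /sigma_matching TT andbT.
by apply/forall_inP => t /TW/andP[/sW-> /sW->].
Qed.

Lemma matched_del W v : matched_up_to_isolated W ->
  matched_up_to_isolated (W :\: (v |: nbrs R v)).
Proof.
move=> gW a w; rewrite !inE !negb_or => /andP[/andP[av Rva] aW] /andP[/andP[wv Rvw] wW] Raw.
rewrite (gW a w) // andbT; apply/andP; split.
  by apply: contraNneq Rva => <-; rewrite R_sym eR.
apply/negP => Rvs; case: (R_partner Rvs Raw) => H; by rewrite H in Rva Rvw.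
Qed.

Lemma loop_nbrs b w : R b b -> R (sigma b) w -> R b w.
Proof.
move=> bb; rewrite R_sym => Rws; rewrite R_sym.
by case: (R_partner Rws bb).
Qed.

(** Let u be t or its partner. An edge from [sigma b] to u puts [v], a member of N'(b), into N'(u).
    An edge from [b] to u forces N'(sigma b) into N'(v); then N'(sigma b) or N'(sigma u) lies in
    N'(b) within [W], minimality of [b] makes the two equal, and u or its partner becomes a
    neighbour of [v]. *)
Lemma minimal_separated W b v t :
  matched_up_to_isolated W -> b \in W -> v \in W -> R b v ->
  (forall c w, c \in W -> w \in W -> R c w ->
     #|W :&: nbrs R b| <= #|W :&: nbrs R c|) ->
  t \in W :\: (v |: nbrs R v) -> sigma t \in W :\: (v |: nbrs R v) ->
  separated b t.
Proof.
move=> gW bW vW Rbv bmin; rewrite !inE !negb_or.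
move=> /andP[/andP[tv Rvt] tW] /andP[/andP[sv Rvs] sW].
have sbW : sigma b \in W by apply: gW Rbv.
have sub_eq c : c \in W -> (exists2 w, w \in W & R c w) ->
    (forall w, w \in W -> R c w -> R b w) -> forall w, w \in W -> R b w -> R c w.
  move=> cW [w0 w0W Rcw0] cb w wW Rbw.
  have sub : W :&: nbrs R c \subset W :&: nbrs R b.
    by apply/subsetP => u; rewrite !inE => /andP[uW Rcu]; rewrite uW cb.
  have /eqP E : W :&: nbrs R c == W :&: nbrs R b by rewrite eqEcard sub (bmin c w0).
  by move/setP/(_ w): E; rewrite !inE wW Rbw.
have not_sb u : ~~ R v u -> ~~ e (sigma b) u.
  move=> Rvu; apply: contra Rvu => esu; rewrite R_sym.
  by apply: (R_left esu); rewrite sigmaK.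
have not_b u : u \in W -> sigma u \in W -> ~~ R v u -> ~~ R v (sigma u) -> ~~ e b u.
  move=> uW suW Rvu Rvsu; apply/negP => ebu.
  have nRsv : ~~ R (sigma b) v.
    by apply: contra Rvu => /(R_left ebu); rewrite R_sym.
  have sb_v w : R (sigma b) w -> R v w.
    have Rvb : R v (sigma (sigma b)) by rewrite sigmaK R_sym.
    move=> Rsw; case: (R_partner Rvb Rsw) => //.
    by rewrite R_sym (negPf nRsv).
  (* In the first case [b] has a loop, so N'(sigma b) lies in N'(b); in the second, [R_partner] puts
     N'(sigma u) into N'(b). *)
  case: (boolP (R b (sigma u))) => Rbsu.
    have bb : R b b.
      apply: (@R_left u); first by rewrite e_sym.
      by rewrite R_sym.
    have : R (sigma b) u.
      apply: sub_eq => //; last exact: eR.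
        by exists b => //; rewrite R_sym eR.
      by move=> w _; apply: loop_nbrs.
    by move/sb_v; apply/negP.
  have : R (sigma u) (sigma b).
    apply: sub_eq => //; last exact: eR.
      by exists u => //; rewrite R_sym eR.
    move=> w wW Rsw.
    have Rbu : R b (sigma (sigma u)) by rewrite sigmaK eR.
    by case: (R_partner Rbu Rsw) => // /(negP Rbsu).
  by rewrite R_sym => /sb_v; apply/negP.
have neq u : ~~ R v u -> b != u by apply: contraNneq => <-; rewrite R_sym.
have nes u : ~~ R v (sigma u) -> sigma b != u.
  by apply: contraNneq => <-; rewrite sigmaK R_sym.
apply/forall_inP => x; rewrite !inE => /orP[]/eqP->;
  apply/forall_inP => y; rewrite !inE => /orP[]/eqP->.
- by rewrite neq ?not_b.
- by rewrite neq ?not_b ?sigmaK.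
- by rewrite nes ?not_sb.
- by rewrite nes ?not_sb ?sigmaK.
Qed.

Theorem koszul_bound_matched d W : matched_up_to_isolated W ->
  (forall T, sigma_matching W T -> #|T| <= d) ->
  koszul_bound K R W d.
Proof.
have [m] := ubnP #|W|; elim: m d W => // m IH d W leW gW WT.
pose b_ok b := (b \in W) && [exists w in W, R b w].
case: (pickP b_ok) => [b0 ok0|none]; last first.
  move=> a i aW ai; apply: exact_at_empty => F; apply/negP.
  move=> /andP[_ /quad_idealP[p [q [pq le]]]].
  have inW x y : (x == x) + (x == y) <= a x - (x \in F) -> x \in W.
    by apply: contraLR => /aW->; rewrite eqxx.
  have pW : p \in W by apply: inW (le p).
  have qW : q \in W by apply: (@inW _ p); rewrite addnC.
  by have /negP[] := none p; rewrite /b_ok pW; apply/existsP; exists q; rewrite qW.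
case: (arg_minnP (fun b => #|W :&: nbrs R b|) ok0) => b /andP[bW /exists_inP[v0 v0W Rbv0]] bmin.
have {}bmin c w : c \in W -> w \in W -> R c w ->
    #|W :&: nbrs R b| <= #|W :&: nbrs R c|.
  by move=> cW wW Rcw; apply: bmin; rewrite /b_ok cW; apply/exists_inP; exists w.
have sbW : sigma b \in W by apply: gW Rbv0.
have extend v T : v \in W -> R b v ->
    sigma_matching (W :\: (v |: nbrs R v)) T -> #|T| < d.
  move=> vW Rbv smT; have smW := sigma_matchingS (subsetDl _ _) smT.
  have /andP[/forall_inP TW _] := smT.
  have bT : b \notin T.
    by apply: contraL Rbv => /TW; rewrite !inE !negb_or R_sym => /andP[/andP[/andP[_ ->]]].
  have sepT t : t \in T -> separated b t.
    by move=> /TW/andP[]; apply: minimal_separated.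
  suff /WT : sigma_matching W (b |: T) by rewrite cardsU1 bT.
  case/andP: smW => /forall_inP TW' /forall_inP sep; apply/andP; split.
    by apply/forall_inP => t; rewrite !inE => /orP[/eqP->|/TW'//]; rewrite bW.
  apply/forall_inP => t; rewrite inE in_set1 => tT.
  apply/forall_inP => u; rewrite inE in_set1 => uT; apply/implyP => tu.
  case/orP: tT tu => [/eqP->|tT]; case/orP: uT => [/eqP->|uT] tu.
  - by rewrite eqxx in tu.
  - exact: sepT.
  - by rewrite separatedC sepT.
  - by have /forall_inP/(_ u uT)/implyP := sep t tT; apply.
have small v : v \in W -> #|W :\: (v |: nbrs R v)| < m.
  move=> vW; rewrite -ltnS; apply: leq_ltn_trans leW; apply: proper_card; rewrite properEneq subsetDl andbT.
  by apply/eqP => /setP/(_ v); rewrite !inE eqxx vW.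
have IHb : koszul_bound K R (W :\: (b |: nbrs R b)) d.
  apply: IH; [exact: small|exact: matched_del|] => T smT.
  by apply: WT; apply: sigma_matchingS smT; apply: subsetDl.
(* [d] cannot be zero, as even the empty matching extends by the edge at [b]. *)
case: d WT extend IHb => [|d] WT extend IHb.
  have /(extend _ _ v0W Rbv0) : sigma_matching (W :\: (v0 |: nbrs R v0)) set0 => //.
  by apply/andP; split; apply/forall_inP => t; rewrite inE.
apply: (@koszul_bound_del_seq _ _ _ R_sym (enum (W :&: nbrs R b))) => [v|].
  rewrite mem_enum !inE => /andP[vW Rbv].
  apply: IH; [exact: small|exact: matched_del|] => T smT.
  exact: (extend v).
have -> : W :\: [set v in enum (W :&: nbrs R b)] = W :\: nbrs R b.
  by apply/setP => w; rewrite !inE mem_enum !inE; case: (w \in W); rewrite ?andbF.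
(* With a loop, [b] was deleted among its own neighbours; otherwise it is now isolated and does not
   affect the bound. *)
case: (boolP (R b b)) => bb.
  by have <- : b |: nbrs R b = nbrs R b by apply/setUidPr; rewrite sub1set inE.
apply: koszul_bound_sub (koszul_bound_isolated R_sym bb _ IHb) => //.
  by apply/subsetP => w; rewrite !inE negb_or; case: (eqVneq w b).
by move=> w; rewrite !inE negb_or => /andP[/andP[]].
Qed.

End Matched.

(** * Products of edges *)

Ltac count_lia :=
  repeat match goal with
  | |- context [nat_of_bool ?b] =>
      lazymatch b with true => fail | false => fail | _ => move: (nat_of_bool b) => ? end
  | |- context [count ?P ?l] => is_var l; move: (count P l) => ?
  end; clear; rewrite /=; lia.

Ltac perm_lia :=
  let P := fresh "P" in apply/permP => P;
  repeat match goal with H : is_true (perm_eq _ _) |- _ =>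
    move/permP/(_ P): H => /= end;
  count_lia.

Section Multisets.
Variable T : eqType.
Implicit Types (C M : seq T).

Lemma leq_size_count C M :
  (forall w, count_mem w C <= count_mem w M) -> size C <= size M.
Proof.
by move/count_subseqP => [s sM /perm_size->]; apply: size_subseq.
Qed.

Lemma perm_eq_count_size C M :
  (forall w, count_mem w C <= count_mem w M) -> size C = size M -> perm_eq C M.
Proof.
move/count_subseqP => [s sM Cs] CM.
have := size_subseq_leqif sM; rewrite -(perm_size Cs) CM => -[_].
by rewrite eqxx => /esym/eqP <-.
Qed.

Variable e : rel T.
Hypothesis e_sym : symmetric e.

(** Lists, read up to permutation, stand for monomials. *)
Inductive edge_product : seq T -> Prop :=
| edge_product_nil : edge_product [::]
| edge_product_cons u v l l' : e u v -> edge_product l ->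
    perm_eq l' [:: u, v & l] -> edge_product l'.

Lemma edge_product_perm l l' : edge_product l -> perm_eq l' l -> edge_product l'.
Proof.
case=> [|u v l0 l1 uv pl l1E] ll'.
  by rewrite (perm_nilP ll'); apply: edge_product_nil.
exact: edge_product_cons uv pl (perm_trans ll' l1E).
Qed.

Lemma edge_product_rem l w : edge_product l -> w \in l ->
  exists t l', [/\ e w t, edge_product l' & perm_eq l [:: w, t & l']].
Proof.
elim=> {l} // u v l l' uv pl IH ll'; rewrite (perm_mem ll') !inE.
case/or3P => [/eqP->|/eqP->|/IH[t [l1 [wt pl1 lE]]]].
- by exists v, l.
- by exists u, l; split; rewrite 1?e_sym //; perm_lia.
- exists t, [:: u, v & l1]; split=> //; last by perm_lia.
  exact: edge_product_cons uv pl1 _.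
Qed.

Lemma edge_product_head l w : edge_product (w :: l) ->
  exists t l', [/\ e w t, edge_product l' & perm_eq l (t :: l')].
Proof.
move=> /edge_product_rem/(_ (mem_head _ _))[t [l' [wt pl' E]]].
by exists t, l'; split=> //; rewrite -(perm_cons w).
Qed.

(** The alternating path from [u] through the two factorizations ends at [p], [q] or [r]; switching
    along it puts [u] in place of that end. The recursion follows the path two edges at a time. *)
Lemma edge_product_exchange u p q r M :
  edge_product (u :: M) -> edge_product [:: p, q, r & M] ->
  [\/ edge_product [:: u, p, q & M], edge_product [:: u, p, r & M]
    | edge_product [:: u, q, r & M]].
Proof.
have [m] := ubnP (size M); elim: m u p q r M => // m IH u p q r M leM uM pqrM.
have [w [l [uw pl Ml]]] := edge_product_head uM.
have wM : w \in [:: p, q, r & M] by rewrite !inE (perm_mem Ml) mem_head !orbT.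
have [t [l2 [wt pl2 lE]]] := edge_product_rem pqrM wM.
have E : perm_eq [:: p, q, r & l] (t :: l2) by perm_lia.
have add x y : edge_product [:: x, y & l] -> edge_product [:: u, x, y & M].
  by move=> xyl; apply: (edge_product_cons uw xyl); perm_lia.
have : t \in [:: p, q, r & l] by rewrite (perm_mem E) mem_head.
rewrite !inE => /or4P[/eqP tp|/eqP tq|/eqP tr|tl].
- by apply: Or33; apply: add; apply: edge_product_perm pl2 _; subst t; perm_lia.
- by apply: Or32; apply: add; apply: edge_product_perm pl2 _; subst t; perm_lia.
- by apply: Or31; apply: add; apply: edge_product_perm pl2 _; subst t; perm_lia.
have lt := perm_to_rem tl; set l3 := rem t l in lt.
have p3 : edge_product [:: p, q, r & l3].
  by apply: edge_product_perm pl2 _; perm_lia.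
have t3 : edge_product (t :: l3) by apply: edge_product_perm pl _; rewrite perm_sym.
have sz : size l3 < m by move: leM; rewrite (perm_size Ml) /= (perm_size lt) /=; lia.
by case: (IH _ _ _ _ _ sz t3 p3) => H; [apply: Or31|apply: Or32|apply: Or33];
  apply: add; apply: edge_product_perm H _; perm_lia.
Qed.

(** Take [u] in excess in [C], with partner [w] there. If [w] is in excess too, [u] and [w] answer.
    Otherwise [w] has a partner [t] in [M]; removing both edges changes the excess only by losing
    [u] and gaining [t], so a solution of the smaller problem is kept, or has [t] replaced by
    [u]. *)
Lemma edge_product_augment M C : irreflexive e ->
  edge_product M -> edge_product C -> size C = (size M).+2 ->
  exists p q, edge_product [:: p, q & M] /\
    forall w, (w == p) + (w == q) <= count_mem w C - count_mem w M.
Proof.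
move=> e_irr; have [m] := ubnP (size M); elim: m M C => // m IH M C leM pM pC sz.
have [u uC] : exists u, count_mem u M < count_mem u C.
  have [/hasP[u _ H]|/hasPn H] := boolP (has (fun u => count_mem u M < count_mem u C) C).
    by exists u.
  suff : size C <= size M by lia.
  apply: leq_size_count => w; case: (boolP (w \in C)) => [/H|/count_memPn->//].
  by rewrite -leqNgt.
have uCin : u \in C by rewrite -has_pred1 has_count; lia.
have [w [C1 [uw pC1 CE]]] := edge_product_rem pC uCin.
have CEc x : count_mem x C = (u == x) + ((w == x) + count_mem x C1).
  by move/permP/(_ (pred1 x)): CE.
have uw' : w != u by apply: contraTneq uw => ->; rewrite e_irr.
case: (ltnP (count_mem w M) (count_mem w C)) => wC.
  exists u, w; split; first exact: (edge_product_cons uw pM).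
  move=> x; case: (eqVneq x u) => [->|_].
    by rewrite eq_sym (negPf uw'); lia.
  by case: (eqVneq x w) => [->|]; lia.
have wM : w \in M.
  by rewrite -has_pred1 has_count; move: wC; rewrite CEc eqxx; lia.
have [t [M1 [wt pM1 ME]]] := edge_product_rem pM wM.
have MEc x : count_mem x M = (w == x) + ((t == x) + count_mem x M1).
  by move/permP/(_ (pred1 x)): ME.
have sC := perm_size CE; have sM := perm_size ME; rewrite /= in sC sM.
have [||p [q [pq le]]] := IH M1 C1 _ pM1 pC1; try lia.
have swap q' : edge_product [:: t, q' & M1] ->
    (forall x, (x == t) + (x == q') <= count_mem x C1 - count_mem x M1) ->
    exists p q, edge_product [:: p, q & M] /\
      forall w, (w == p) + (w == q) <= count_mem w C - count_mem w M.
  move=> tq le'; exists u, q'; split.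
    by apply: (edge_product_cons uw tq); perm_lia.
  move=> x; have := le' x; move: uC; rewrite !CEc !MEc !(eq_sym _ x).
  by case: (eqVneq x u) => [->|_]; rewrite ?eqxx; count_lia.
case: (eqVneq p t) => [pt|pt]; first by apply: (swap q); rewrite -pt.
case: (eqVneq q t) => [qt|qt].
  apply: (swap p); rewrite -qt; last by move=> x; rewrite addnC.
  by apply: edge_product_perm pq _; perm_lia.
exists p, q; split; first by apply: (edge_product_cons wt pq); perm_lia.
move=> x; have := le x; rewrite CEc MEc !(eq_sym _ x).
case: (eqVneq x t) => [xt|_]; first by rewrite xt !(eq_sym t) (negPf pt) (negPf qt).
count_lia.
Qed.

Variable sigma : T -> T.
Hypothesis sigma_join : forall a v w, e a v -> e (sigma a) w -> e v w.

(** The partner of [sigma b] in the factorization is adjacent to [t], by [sigma_join]. *)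
Lemma edge_product_left M b t v :
  e b t -> edge_product [:: sigma b, v & M] -> edge_product [:: t, v & M].
Proof.
move=> bt /edge_product_head[f [l [sf pl E]]].
by apply: (edge_product_cons (sigma_join bt sf) pl); rewrite perm_cons.
Qed.

(** Let [f] be the partner of [sigma a]. If it is [z], then [z] may replace [a]. Otherwise it is a
    factor of [M], and the exchange of [z] against [a], [v], [f] removes one of these; if [f] is
    removed, it returns in place of [a]. *)
Lemma edge_product_partner M z a v : involutive sigma ->
  edge_product [:: z, sigma a & M] -> edge_product [:: a, v & M] ->
  edge_product [:: z, a & M] \/ edge_product [:: z, v & M].
Proof.
move=> sigmaK zaM avM.
have replace y l : e (sigma a) y -> edge_product (a :: l) -> edge_product (y :: l).
  move=> ay /edge_product_head[f [l' [af pl' E]]].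
  by apply: (edge_product_cons (l := l') (u := y) (v := f)); rewrite ?perm_cons // e_sym (sigma_join af ay).
have : edge_product [:: sigma a, z & M].
  by apply: edge_product_perm zaM _; perm_lia.
move=> /edge_product_head[f [l [af pl E]]].
case: (eqVneq z f) => [zf|zf].
  by right; apply: replace avM; rewrite zf.
have fM : f \in M.
  have : f \in z :: M by rewrite (perm_mem E) mem_head.
  by rewrite inE eq_sym (negPf zf).
have ME := perm_to_rem fM; set M' := rem f M in ME.
have zM' : edge_product (z :: M') by apply: edge_product_perm pl _; perm_lia.
have avfM' : edge_product [:: a, v, f & M'] by apply: edge_product_perm avM _; perm_lia.
case: (edge_product_exchange zM' avfM') => H.
- right.
  have : edge_product [:: f, z, v & M'].
    by apply: replace af _; apply: edge_product_perm H _; perm_lia.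
  by move/edge_product_perm; apply; perm_lia.
- by left; apply: edge_product_perm H _; perm_lia.
- by right; apply: edge_product_perm H _; perm_lia.
Qed.

End Multisets.

(** * Even-connection and the quadratic generators of the colon ideal *)

Section EdgePower.
Variables (n : nat) (e : rel 'I_n).
Hypothesis e_sym : symmetric e.
Hypothesis e_irr : irreflexive e.

Definition ends (t : seq ('I_n * 'I_n)) := flatten [seq [:: p.1; p.2] | p <- t].

Lemma size_ends t : size (ends t) = (size t).*2.
Proof. by elim: t => //= p t; rewrite /ends /= => ->. Qed.

Lemma count_ends t w : count_mem w (ends t) = \sum_(p <- t) edge_mono p w.
Proof.
elim: t => [|p t IH]; first by rewrite big_nil.
by rewrite big_cons -IH /edge_mono ffunE /= !(eq_sym w) addnA.
Qed.

Lemma edge_product_ends t :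
  all (fun p => e p.1 p.2) t -> edge_product e (ends t).
Proof.
elim: t => [_|p t IH /= /andP[ep /IH pt]]; first exact: edge_product_nil.
exact: (edge_product_cons ep pt).
Qed.

Lemma edge_product_endsP l : edge_product e l ->
  exists2 t, all (fun p => e p.1 p.2) t & perm_eq l (ends t).
Proof.
elim=> [|u v l0 l' uv _ [t et lt] l'E]; first by exists [::].
exists ((u, v) :: t); rewrite /= ?uv //.
by apply: perm_trans l'E _; rewrite /ends /= !perm_cons.
Qed.

Lemma edge_power_memP k (a : mono n) : reflect
  (exists C, [/\ edge_product e C, size C = k.*2 & forall w, count_mem w C <= a w])
  (edge_power_mem e k a).
Proof.
apply: (iffP existsP) => [[t /andP[et /forallP le]]|[C [pC sC le]]].
  exists (ends t); split; [exact: edge_product_ends|by rewrite size_ends size_tuple|].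
  by move=> w; rewrite count_ends.
have [t et Ct] := edge_product_endsP pC.
have st : size t == k.
  by rewrite -(inj_eq double_inj) -size_ends -(perm_size Ct) sC.
exists (Tuple st); rewrite et; apply/forallP => v.
by rewrite -count_ends; move/permP: Ct => <-.
Qed.

Variables (s : nat) (es : 'I_s -> 'I_n * 'I_n).
Hypothesis hes : forall k, e (es k).1 (es k).2.

Definition edge_colon := colon_mem (edge_power_mem e s.+1) (edges_prod es).

Definition even_connected p q := edge_colon [ffun w => (w == p) + (w == q)].

Definition edge_ends := ends [seq es k | k <- enum 'I_s].

Lemma edges_prodE w : edges_prod es w = count_mem w edge_ends.
Proof. by rewrite ffunE count_ends big_map big_enum. Qed.

Lemma edge_product_edge_ends : edge_product e edge_ends.
Proof. by apply: edge_product_ends; apply/allP => _ /mapP[k _ ->]. Qed.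

Lemma size_edge_ends : size edge_ends = s.*2.
Proof. by rewrite size_ends size_map size_enum_ord. Qed.

Lemma even_connectedP p q : reflect (edge_product e [:: p, q & edge_ends])
  (even_connected p q).
Proof.
have cE w : (w == p) + (w == q) + edges_prod es w = count_mem w [:: p, q & edge_ends].
  by rewrite edges_prodE /= !(eq_sym w) addnA.
apply: (iffP (edge_power_memP _ _)) => [[C [pC sC le]]|pq].
  (* Both monomials have degree 2(s + 1), so divisibility is equality. *)
  apply: edge_product_perm pC _; rewrite perm_sym; apply: perm_eq_count_size.
    by move=> w; have := le w; rewrite ffunE ffunE cE.
  by rewrite sC /= size_edge_ends.
exists [:: p, q & edge_ends]; split=> //; first by rewrite /= size_edge_ends.
by move=> w; rewrite ffunE ffunE cE.
Qed.

(** A product of s + 1 edges dividing x^a e_1...e_s augments e_1...e_s by some p, q from its excess,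
    and that excess divides x^a. *)
Lemma edge_colon_quad a : edge_colon a = quad_ideal even_connected a.
Proof.
apply/idP/quad_idealP => [/edge_power_memP[C [pC sC le]]|[p [q [/even_connectedP pq le]]]].
  have [|p [q [pq lepq]]] := edge_product_augment e_sym e_irr edge_product_edge_ends pC.
    by rewrite sC size_edge_ends.
  exists p, q; split; first exact/even_connectedP.
  move=> w; apply: leq_trans (lepq w) _.
  by have := le w; rewrite ffunE edges_prodE leq_subLR addnC.
apply/edge_power_memP; exists [:: p, q & edge_ends].
split=> //; first by rewrite /= size_edge_ends.
move=> w; rewrite ffunE edges_prodE /= addnA leq_add2r !(eq_sym _ w); exact: le.
Qed.

Lemma even_connected_sym : symmetric even_connected.
Proof.
move=> p q; apply/even_connectedP/even_connectedP => /edge_product_perm; apply; perm_lia.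
Qed.

Lemma even_connected_edge p q : e p q -> even_connected p q.
Proof.
by move=> pq; apply/even_connectedP; apply: (edge_product_cons pq edge_product_edge_ends).
Qed.

End EdgePower.

(** * Very well-covered graphs *)

Section Hall.
Variable T : finType.
Implicit Types (r : rel T) (X Y A : {set T}).

Definition neighbors r X := [set y | [exists x in X, r x y]].

Lemma neighborsP r X y :
  reflect (exists2 x, x \in X & r x y) (y \in neighbors r X).
Proof. by rewrite inE; apply: exists_inP. Qed.

(** A nonempty proper tight subset is matched first and the rest is matched outside its neighbours;
    if there is none, any single pair may be fixed. *)
Lemma hall_marriage r A :
  (forall X, X \subset A -> #|X| <= #|neighbors r X|) ->
  exists2 f : T -> T, {in A &, injective f} & {in A, forall x, r x (f x)}.
Proof.
have [m] := ubnP #|A|; elim: m r A => // m IH r A leA hall.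
have [->|[a aA]] := set_0Vmem A.
  by exists id => x; rewrite inE.
pose tight X := [&& X \proper A, X != set0 & #|neighbors r X| <= #|X|].
case: (pickP tight) => [X /and3P[pX X0 tX]|notight].
  have sX := proper_sub pX.
  have [f1 inj1 r1] : exists2 f : T -> T,
      {in X &, injective f} & {in X, forall x, r x (f x)}.
    apply: IH => [|Y YX]; last by apply: hall; apply: subset_trans sX.
    by have := proper_card pX; lia.
  pose r' x y := r x y && (y \notin neighbors r X).
  have [f2 inj2 r2] : exists2 f : T -> T,
      {in A :\: X &, injective f} & {in A :\: X, forall x, r' x (f x)}.
    apply: IH => [|Y].
      have := cardsD A X; rewrite (setIidPr sX).
      by have := proper_card pX; rewrite -card_gt0 in X0; lia.
    rewrite subsetD => /andP[YA YX].
    have := hall (X :|: Y); rewrite subUset sX YA => /(_ isT).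
    rewrite cardsU disjoint_setI0 1?disjoint_sym // cards0 subn0.
    have : neighbors r (X :|: Y) \subset neighbors r X :|: neighbors r' Y.
      apply/subsetP => y /neighborsP[x xXY rxy]; rewrite in_setU.
      case: (boolP (y \in neighbors r X)) => //= yX.
      apply/neighborsP; exists x; last by rewrite /r' rxy.
      case/setUP: xXY => // xX; case/neighborsP: yX; by exists x.
    by move/subset_leq_card; rewrite cardsU; lia.
  exists (fun x => if x \in X then f1 x else f2 x) => [x y xA yA|x xA].
    have f12 u w : u \in X -> w \in A -> w \notin X -> f1 u <> f2 w.
      move=> uX wA wX E; have /andP[_ /neighborsP[]] : r' w (f2 w).
        by apply: r2; rewrite inE wX.
      by exists u => //; rewrite -E r1.
    case: ifP => xX; case: ifP => yX.
    - exact: inj1.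
    - by move/f12 => -[]//; rewrite yX.
    - by move/esym/f12 => -[]//; rewrite xX.
    - by apply: inj2; rewrite inE ?xX ?yX.
  case: ifP => xX; first exact: r1.
  by have /andP[] : r' x (f2 x) by apply: r2; rewrite inE xX.
have [y ray] : exists y, r a y.
  have : 0 < #|neighbors r [set a]|.
    by apply: leq_trans (hall _ _); rewrite ?cards1 ?sub1set.
  by case/card_gt0P => y /neighborsP[x /set1P->]; exists y.
pose r' x z := r x z && (z != y).
have [f inj rf] : exists2 f : T -> T,
    {in A :\ a &, injective f} & {in A :\ a, forall x, r' x (f x)}.
  apply: IH => [|Y YA]; first by have := cardsD1 a A; rewrite aA; lia.
  have [->|Y0] := eqVneq Y set0; first by rewrite cards0.
  have pY : Y \proper A by apply: sub_proper_trans YA (properD1 aA).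
  have := notight Y; rewrite /tight pY Y0 /= => /negbT; rewrite -ltnNge.
  rewrite (cardsD1 y (neighbors r Y)) => lt; apply: leq_trans (_ : #|neighbors r Y :\ y| <= _).
    by case: (y \in neighbors r Y) lt => /=; lia.
  apply: subset_leq_card; apply/subsetP => z /setD1P[zy /neighborsP[x xY rxz]].
  by apply/neighborsP; exists x; rewrite // /r' rxz.
exists (fun x => if x == a then y else f x) => [x z xA zA|x xA].
  have fy u : u \in A -> u != a -> f u <> y.
    move=> uA ua E; have /andP[_] : r' u (f u) by apply: rf; rewrite !inE ua.
    by rewrite E eqxx.
  case: eqVneq => [->|xa]; case: eqVneq => [->|za] //.
  - by move/esym/fy => -[].
  - by move/fy => -[].
  - by apply: inj; rewrite !inE ?xa ?za.
case: eqVneq => [->//|xa].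
by have /andP[] : r' x (f x) by apply: rf; rewrite !inE xa.
Qed.

End Hall.

(** * Independent sets and the perfect matching of a very well-covered graph *)

Section VeryWellCovered.
Variables (n : nat) (e : rel 'I_n).
Hypothesis e_sym : symmetric e.
Hypothesis e_irr : irreflexive e.
Hypothesis Hvwc : very_well_covered e.
Implicit Types (A I S : {set 'I_n}).

Definition independent I := [forall u in I, forall v in I, ~~ e u v].

Lemma independentP I : reflect {in I &, forall u v, ~~ e u v} (independent I).
Proof.
apply: (iffP forall_inP) => [H u v uI vI|H u uI].
  by have /forall_inP := H u uI; apply.
by apply/forall_inP => v vI; apply: H.
Qed.

(** [S] is the complement of a minimal vertex cover inside the complement of [I]. *)
Lemma independent_extend I : independent I ->
  exists S, [/\ independent S, I \subset S & 2 * #|S| = n].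
Proof.
move=> /independentP indI.
have coverI : vertex_cover e (~: I).
  apply/forallP => u; apply/forallP => v; apply/implyP => uv; rewrite !inE -negb_and.
  by apply/negP => /andP[uI vI]; have := indI u v uI vI; rewrite uv.
have [C minC sCI] := minset_exists coverI.
exists (~: C); split; last 1 first.
- have := cardsC C; rewrite card_ord; have := Hvwc.2 C minC; lia.
- apply/independentP => u v; rewrite !inE => uC vC; apply/negP => uv.
  have /forallP/(_ u)/forallP/(_ v) := minsetp minC.
  by rewrite uv (negPf uC) (negPf vC).
- by rewrite -setCS setCK.
Qed.

Lemma independent_card I : independent I -> 2 * #|I| <= n.
Proof.
by move=> /independent_extend[S [_ /subset_leq_card IS cardS]]; lia.
Qed.

(** Let [S] be a maximal independent set containing a neighbour of some [a] in [A]. Exchanging the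
    neighbours of [A] in [S] for [A] cannot enlarge [S], which bounds the part of [A] outside [S];
    the part inside omits [a], falls under induction, and has its neighbours outside [S]. *)
Lemma independent_neighbors A : independent A -> #|A| <= #|neighbors e A|.
Proof.
have [m] := ubnP #|A|; elim: m A => // m IH A leA /independentP indA.
have [->|[a aA]] := set_0Vmem A; first by rewrite cards0.
have [b ab] := Hvwc.1 a.
have bA : b \in neighbors e A by apply/neighborsP; exists a.
have [|S [/independentP indS]] := @independent_extend [set b].
  by apply/independentP => u v /set1P-> /set1P->; rewrite e_irr.
rewrite sub1set => bS cardS.
have exch : #|A :\: S| <= #|neighbors e A :&: S|.
  have ind' : independent (A :|: (S :\: neighbors e A)).
    have AS u v : u \in A -> v \notin neighbors e A -> ~~ e u v.
      by move=> uA; apply: contra => uv; apply/neighborsP; exists u.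
    apply/independentP => u v /setUP[uA|/setDP[uS uN]] /setUP[vA|/setDP[vS vN]].
    - exact: indA.
    - exact: AS.
    - by rewrite e_sym AS.
    - exact: indS.
  have : #|A :|: (S :\: neighbors e A)| <= #|S| by have := independent_card ind'; lia.
  have -> : A :|: (S :\: neighbors e A) = (A :\: S) :|: (S :\: neighbors e A).
    apply/setP => x; rewrite in_setU in_setU !in_setD; case: (boolP (x \in S)) => //= xS.
    case: (boolP (x \in A)) => //= xA; rewrite ?andbT.
    symmetry; apply/negP => /neighborsP[y yA yx].
    by have := indA y x yA xA; rewrite yx.
  rewrite cardsU.
  have -> : (A :\: S) :&: (S :\: neighbors e A) = set0.
    by apply/setP => x; rewrite in_setI !in_setD in_set0; case: (x \in S); rewrite ?andbF.
  rewrite cards0; have := cardsID (neighbors e A) S; by rewrite setIC subn0 => <-; rewrite leq_add2r.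
have aS : a \notin S.
  by apply/negP => aS; have := indS a b aS bS; rewrite ab.
have IHA : #|A :&: S| <= #|neighbors e (A :&: S)|.
  apply: IH; last by apply/independentP => u v /setIP[uA _] /setIP[vA _]; apply: indA.
  apply: leq_trans (_ : #|A| <= m); last by [].
  apply: proper_card; rewrite properEneq subsetIl andbT.
  by apply/eqP => /setP/(_ a); rewrite inE aA (negPf aS).
have sub : neighbors e (A :&: S) \subset neighbors e A :\: S.
  apply/subsetP => y /neighborsP[x /setIP[xA xS] xy]; rewrite in_setD.
  apply/andP; split; last by apply/neighborsP; exists x.
  by apply/negP => yS; have := indS x y xS yS; rewrite xy.
rewrite -(cardsID S A) -(cardsID S (neighbors e A)) addnC.
by apply: leq_add => //; apply: leq_trans IHA (subset_leq_card sub).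
Qed.

(* Favaron's characterization of very well-covered graphs. *)
Theorem very_well_covered_matching : exists sigma : 'I_n -> 'I_n,
  [/\ involutive sigma, forall v, e v (sigma v)
    & forall a v w, e a v -> e (sigma a) w -> e v w].
Proof.
have [|S [indS _ cardS]] := @independent_extend set0.
  by apply/independentP => u v; rewrite inE.
have [|f f_inj ef] := @hall_marriage _ e S.
  move=> X XS; apply: independent_neighbors; apply/independentP => u v uX vX.
  by apply: (independentP _ indS); apply: (subsetP XS).
have fS x : x \in S -> f x \notin S.
  move=> xS; apply/negP => fxS.
  by have := independentP _ indS x (f x) xS fxS; rewrite ef.
have imf : f @: S = ~: S.
  apply/eqP; rewrite eqEcard; apply/andP; split.
    by apply/subsetP => _ /imsetP[x xS ->]; rewrite inE fS.
  rewrite card_in_imset // -(leq_add2l #|S|) cardsC card_ord.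
  by rewrite addnn -mul2n cardS.
(* Off [S] this inverts [f]; by [imf] the default is never taken. *)
pose sigma v := if v \in S then f v else odflt v [pick x in S | f x == v].
have sigmaS v : v \in S -> sigma v = f v by rewrite /sigma => ->.
have sigmaC v : v \notin S -> sigma v \in S /\ f (sigma v) = v.
  move=> vS; rewrite /sigma (negPf vS); case: pickP => [x /andP[xS /eqP]//|].
  have : v \in f @: S by rewrite imf inE.
  by case/imsetP => x xS -> /(_ x); rewrite xS eqxx.
have sigmaK : involutive sigma.
  move=> v; case: (boolP (v \in S)) => vS; last first.
    by have [sS fs] := sigmaC v vS; rewrite sigmaS.
  rewrite (sigmaS v vS); have [sS fs] := sigmaC _ (fS v vS).
  exact: f_inj.
have e_sigma v : e v (sigma v).
  case: (boolP (v \in S)) => vS; first by rewrite sigmaS // ef.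
  by have [sS {1}<-] := sigmaC v vS; rewrite e_sym ef.
(* If [v] and [w] were not adjacent, a maximal independent set [I] through both would miss [a] and
   [sigma a]. Meeting every other matching edge at most once, it would be smaller than [S]; the map
   [g] names a matching edge by its end in [S]. *)
exists sigma; split=> // a v w av aw; apply: contraT => vw.
have [|I [/independentP indI]] := @independent_extend [set v; w].
  apply/independentP => x y /set2P[]-> /set2P[]->; rewrite ?e_irr //.
  by rewrite e_sym.
rewrite subUset !sub1set => /andP[vI wI] cardI.
have aI : a \notin I by apply/negP => aI; have := indI a v aI vI; rewrite av.
have saI : sigma a \notin I.
  by apply/negP => saI; have := indI _ w saI wI; rewrite aw.
pose g t := if t \in S then t else sigma t.
pose s0 := g a.
have gS t : g t \in S by rewrite /g; case: ifP => // /negbT/sigmaC[].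
have g_inj : {in I &, injective g}.
  move=> t u tI uI; rewrite /g; case: ifP => tS; case: ifP => uS //.
  - move=> tu; have := indI u t uI tI; by rewrite tu e_sigma.
  - move=> tu; have := indI t u tI uI; by rewrite -tu e_sigma.
  - exact: (can_inj sigmaK).
have gI : g @: I \subset S :\ g a.
  apply/subsetP => _ /imsetP[t tI ->]; rewrite !inE gS andbT.
  apply: contraTneq tI; rewrite /g; case: ifP => tS; case: ifP => aS.
  - by move->.
  - by move->.
  - by move=> ta; rewrite -ta sigmaK in saI.
  - by move/(can_inj sigmaK)->.
have := subset_leq_card gI; rewrite card_in_imset //.
have -> : #|I| = #|S| by lia.
by rewrite (cardsD1 (g a) S) gS ltnn.
Qed.

End VeryWellCovered.

(** * Betti numbers *)

Section Betti.
Variables (K : fieldType) (n : nat) (I : mono n -> bool) (a : mono n).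
Local Open Scope ring_scope.
Implicit Types (F G : {set 'I_n}).

Definition koszul_faces F :=
  (F \subset [set v | (0 < a v)%N]) && I [ffun v => (a v - (v \in F))%N].

Hypothesis facesD : forall F v, koszul_faces (v |: F) -> koszul_faces F.

Definition chain_of_row (z : 'rV[K]_(nsets n)) F := z 0 (enum_rank F).
Definition row_of_chain (c : {set 'I_n} -> K) : 'rV[K]_(nsets n) :=
  \row_q c (enum_val q).

(** By [facesD] the zero padding discards no facet of a face. The signs agree because [v] is not
    below itself, so counting in [F] or in [G] is the same. *)
Lemma koszul_mxE i F G : F \in koszul_basis I a i ->
  koszul_mx K I a i (enum_rank F) (enum_rank G) =
  \sum_(v | (v \notin G) && (F == v |: G)) ksgn K v G.
Proof.
move=> FB; rewrite mxE /= !enum_rankK FB /=.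
have faceE v : (v \in F) && (G == F :\ v) = (v \notin G) && (F == v |: G).
  apply/andP/andP => -[vF /eqP E]; rewrite E.
    by rewrite setD11 setD1K.
  by rewrite setU11 setU1K.
case: ifP => GB.
  rewrite (eq_bigl _ _ faceE); apply: eq_bigr => v /andP[vG /eqP ->].
  congr (_ ^+ _); apply: eq_card => w; rewrite !inE.
  by case: eqVneq => [->|//]; rewrite ltnn (negPf vG).
rewrite big_pred0 // => v; apply/negP => /andP[vG /eqP E].
move/negP: GB; apply; move: FB; rewrite !inE E cardsU1 vG => /andP[/eqP <- D].
by rewrite eqxx; apply: (facesD D).
Qed.

Lemma chain_mul_koszul_mx i (z : 'rV[K]_(nsets n)) G :
  (forall F, chain_of_row z F != 0 -> F \in koszul_basis I a i) ->
  chain_of_row (z *m koszul_mx K I a i) G = bound (chain_of_row z) G.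
Proof.
move=> zB; rewrite /chain_of_row mxE (reindex enum_rank) /=; last first.
  by apply: onW_bij; apply: enum_rank_bij.
rewrite (eq_bigr (fun F => \sum_(v | v \notin G)
   (if F == v |: G then chain_of_row z F * ksgn K v G else 0))); last first.
  move=> F _; rewrite -/(chain_of_row z F).
  have [->|/zB FB] := eqVneq (chain_of_row z F) 0.
    by rewrite mul0r big1 // => v _; rewrite mul0r if_same.
  by rewrite koszul_mxE // mulr_sumr -big_mkcondr.
rewrite exchange_big /= /bound [RHS](bigID (fun v => v \in G)) /=.
rewrite [X in _ = X + _]big1 ?add0r => [|v vG]; last by rewrite /contract vG.
apply: eq_bigr => v vG; rewrite -big_mkcond big_pred1_eq /contract (negPf vG).
by rewrite mulrC.
Qed.

(** Rank-nullity on the row space of [E], the span of the faces of size [i]: its cycles are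
    boundaries, so the two ranks add up to at least the number of faces and the truncated difference
    is zero. *)
Lemma exact_betti i : exact_at K koszul_faces i -> betti K I i a = 0%N.
Proof.
move=> ex; set B := koszul_basis I a i.
have BP F : (F \in B) = (koszul_faces F && (#|F| == i)) by rewrite inE andbC.
pose E : 'M[K]_(#|B|, nsets n) := \matrix_(r, q) (enum_val q == enum_val r)%:R.
have rE : \rank E = #|B|.
  apply/eqP; apply/row_freeP; exists E^T; apply/matrixP => r r'; rewrite !mxE.
  rewrite (bigD1 (enum_rank (enum_val r))) //= !mxE enum_rankK eqxx mul1r.
  rewrite big1 ?addr0 => [|q]; first by rewrite (inj_eq enum_val_inj).
  by rewrite !mxE -(inj_eq enum_val_inj) enum_rankK => /negPf->; rewrite mul0r.
have kerB : (E :&: kermx (koszul_mx K I a i) <= koszul_mx K I a i.+1)%MS.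
  apply/rV_subP => z; rewrite sub_capmx => /andP[/submxP[w zE] /sub_kermxP zker].
  have zB F : chain_of_row z F != 0 -> F \in B.
    apply: contraNT => FB; rewrite /chain_of_row zE mxE big1 // => r _.
    rewrite !mxE enum_rankK; case: eqVneq => [FE|]; last by rewrite mulr0.
    by move: FB; rewrite FE enum_valP.
  have [||y yD yz] := ex (chain_of_row z).
  - by move=> F /zB; rewrite BP => /andP[-> /eqP].
  - by move=> G; rewrite -(chain_mul_koszul_mx _ zB) zker /chain_of_row mxE.
  have yK F : chain_of_row (row_of_chain y) F = y F.
    by rewrite /chain_of_row mxE enum_rankK.
  suff -> : z = row_of_chain y *m koszul_mx K I a i.+1 by apply: submxMl.
  have yB F : chain_of_row (row_of_chain y) F != 0 -> F \in koszul_basis I a i.+1.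
    by rewrite yK => /yD[D c]; rewrite inE c eqxx.
  apply/rowP => q; rewrite -[q]enum_valK.
  rewrite -[LHS]/(chain_of_row z (enum_val q)).
  rewrite -[RHS]/(chain_of_row (row_of_chain y *m _) (enum_val q)).
  by rewrite (chain_mul_koszul_mx _ yB) (eq_bound yK) yz.
have := mxrank_mul_ker E (koszul_mx K I a i); rewrite rE.
have := mxrankS kerB; have := mxrankM_maxr E (koszul_mx K I a i).
by rewrite /betti -/B; lia.
Qed.

End Betti.

Theorem theorem4p7 (K : fieldType) (n : nat) (e : rel 'I_n)
  (e_sym : symmetric e) (e_irr : irreflexive e)
  (Hvwc : very_well_covered e)
  (s : nat) (hs : (1 <= s)%N) (es : 'I_s -> 'I_n * 'I_n)
  (hes : forall k, e (es k).1 (es k).2) :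
  reg_le K (colon_mem (edge_power_mem e s.+1) (edges_prod es)) (nu e + 1).
Proof.
have [sigma [sigmaK e_sigma join]] := very_well_covered_matching e_sym e_irr Hvwc.
set R := even_connected e es.
have R_sym : symmetric R by apply: even_connected_sym.
have eR v w : e v w -> R v w by apply: even_connected_edge.
have R_left b t v : e b t -> R (sigma b) v -> R t v.
  move=> bt /even_connectedP H; apply/even_connectedP.
  exact: (edge_product_left e_sym join bt H).
have R_partner z a v : R z (sigma a) -> R a v -> R z a \/ R z v.
  move=> /even_connectedP H1 /even_connectedP H2.
  by case: (edge_product_partner e_sym join sigmaK H1 H2) => H; [left|right];
    apply/even_connectedP.
have small T : sigma_matching e sigma setT T -> #|T| <= nu e.
  move=> /andP[_ /forall_inP sep].
  have inj : injective (fun t => (t, sigma t)) by move=> t u [].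
  rewrite -(card_imset _ inj).
  apply: (@leq_bigmax_cond _ (induced_matching e) (fun M => #|M|)).
  apply/andP; split.
    by apply/forall_inP => _ /imsetP[t _ ->].
  apply/forall_inP => _ /imsetP[t tT ->]; apply/forall_inP => _ /imsetP[u uT ->].
  apply/implyP; rewrite (inj_eq inj) => tu.
  by have /forall_inP/(_ u uT)/implyP/(_ tu) := sep t tT.
(* The full vertex set is trivially stable under [sigma], which starts the induction. *)
have bnd : koszul_bound K R setT (nu e).
  apply: (koszul_bound_matched (e := e) sigmaK) => //.
  by move=> a w _ _ _; rewrite inE.
move=> i a; apply: contra_notT => lt.
have colonE b : edge_colon e es b = quad_ideal R b by apply: edge_colon_quad.
have facesE : kcomplex (quad_ideal R) a =1 koszul_faces (edge_colon e es) a.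
  move=> F; rewrite /koszul_faces colonE; congr (_ && _).
  by apply: eq_upward; [apply: upward_quad|move=> w; rewrite ffunE].
apply: exact_betti.
  by move=> F v; rewrite -!facesE; apply: kcomplexS; apply: upward_quad.
apply: eq_exact_at facesE _; apply: bnd; first by move=> w; rewrite inE.
by rewrite -ltnNge in lt; rewrite -addnA.
Qed.
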